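(* Let $G$ be a baseline cdf and let $a,b,m,n>0$. Put, for $k=0,1,2,\dots$, $$\mu_k=\sum_{i=0}^{\infty}\sum_{j=k}^{\infty}\frac{(-1)^{i+j+k}}{B(m,n)\,(m+i)}\binom{n-1}{i}\binom{m+i}{j}\binom{j}{k}.$$ Then, for $t>0$, $$F^{BKwG}(t;a,b,m,n)=\sum_{k=0}^{\infty}\mu_k\left[F^{KwG}(t;a,b)\right]^k .$$
   Context: $G$ is the cdf of a baseline distribution with pdf $g(t)=\frac{d}{dt}G(t)$, $t>0$. $B(m,n)$ is the beta function and $I_x(m,n)=B(m,n)^{-1}\int_0^x v^{m-1}(1-v)^{n-1}\,dv$ is the incomplete beta function ratio. $\binom{x}{i}=x(x-1)\cdots(x-i+1)/i!$ is the binomial coefficient for real $x$. The Kumaraswamy-$G$ distribution $Kw\text{-}G(a,b)$ has cdf $F^{KwG}(t;a,b)=1-[1-G(t)^a]^b$. The Beta Kumaraswamy-$G$ ($BKw\text{-}G$) distribution with parameters $a,b,m,n>0$ has cdf $F^{BKwG}(t;a,b,m,n)=I_{1-[1-G(t)^a]^b}(m,n)$.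
   Formalization: The formal theorem assumes that the iterated series defining every μ_k converges; for non-integer m the inner series (i=0) diverges for k>m, so μ_k is undefined there, and the claim has content exactly for positive integers m. *)

(* Defs.v *)
From HB Require Import structures.
From mathcomp Require Import all_boot all_order all_algebra.
From mathcomp Require Import all_classical all_reals all_analysis.
Set Implicit Arguments.
Unset Strict Implicit.
Unset Printing Implicit Defensive.
Import Order.TTheory GRing.Theory Num.Theory.
Import numFieldNormedType.Exports.
Local Open Scope classical_set_scope.
Local Open Scope ring_scope.

(* The library's [beta_fun] only takes natural parameters. The value of the
   integrand at v = 0 and v = 1 is irrelevant: the integral is Lebesgue's. *)
Definition inc_beta (R : realType) (m n x : R) : R :=
  \int[@lebesgue_measure R]_(v in `[0, x]) (v `^ (m - 1) * (1 - v) `^ (n - 1)).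

Definition betaR (R : realType) (m n : R) : R := inc_beta m n 1.

Definition inc_beta_ratio (R : realType) (m n x : R) : R :=
  (betaR m n)^-1 * inc_beta m n x.

Definition rbin (R : realType) (x : R) (i : nat) : R :=
  (\prod_(l < i) (x - l%:R)) / (i`!)%:R.

Definition KwG_cdf (R : realType) (G : R -> R) (a b t : R) : R :=
  1 - (1 - G t `^ a) `^ b.

Definition BKwG_cdf (R : realType) (G : R -> R) (a b m n t : R) : R :=
  inc_beta_ratio m n (1 - (1 - G t `^ a) `^ b).

Definition mu_term (R : realType) (m n : R) (k i j : nat) : R :=
  (-1) ^+ (i + j + k) / (betaR m n * (m + i%:R))
  * rbin (n - 1) i * rbin (m + i%:R) j * 'C(j, k)%:R.

(* [s] is the value of the iterated series sum_(i >= 0) sum_(j >= k) defining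
   mu_k. This is a relation rather than a total function because the inner
   series may diverge: when m is not an integer, its terms for i = 0 do not
   tend to 0 as soon as k > m + 1. *)
Definition is_mu (R : realType) (m n : R) (k : nat) (s : R) : Prop :=
  exists u : R^nat,
    (forall i, (\sum_(k <= j < N) mu_term m n k i j) @[N --> \oo] --> u i) /\
    series u @ \oo --> s.

(* [G] is the cdf of the random variable [X] and [g] is its pdf on t > 0. *)
Definition baseline_cdf d (T : measurableType d) (R : realType)
    (P : probability T R) (X : {RV P >-> R}) (G g : R -> R) : Prop :=
  (forall t : R, cdf X t = (G t)%:E) /\
  (forall t : R, 0 < t -> is_derive t (1 : R) G (g t)).

(* Main.v *)
Require Import Defs.
From HB Require Import structures.
From mathcomp Require Import all_boot all_order all_algebra.
From mathcomp Require Import all_classical all_reals all_analysis.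
From mathcomp Require Import measurable_realfun ring lra.
Set Implicit Arguments.
Unset Strict Implicit.
Unset Printing Implicit Defensive.
Import Order.TTheory GRing.Theory Num.Theory.
Import numFieldNormedType.Exports.
Local Open Scope classical_set_scope.
Local Open Scope ring_scope.

(** The double series comes from inserting the expansion of [y ^ (m + i)], with
[y = 1 - (1 - y)], in powers of [1 - y] and then of [y] into

  [I_y(m, n) = B(m, n)^-1 sum_i (-1)^i C(n-1, i) y^(m+i) / (m+i)].

Write [S(x, k)] for the series over [j >= k] of [(-1)^(j+k) C(x, j) C(j, k)],
the coefficient of [y^k] so obtained for [y^x]. Its partial sums have a closed
form ([double_binom_sum]), from which two facts follow.

- If [x = p] is a natural number, [S(p, k)] is a finite sum, equal to 1 when
  [k = p] and to 0 otherwise ([double_binom_sum_nat]).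
- If [x] is not a natural number and [k >= x + 1], the first term of [S(x, k)]
  is nonzero and no term is smaller in absolute value ([double_binom_growing]),
  so the series diverges.

Applied to [x = m], the second fact shows that, [B(m, n)] being nonzero, the
coefficients [mu_k] can all exist only when [m] is a natural number
([is_mu_nat]). The first one then
computes them: [mu_k] is [(-1)^i C(n-1, i) / (B(m, n) k)] when [k = m + i], and
0 when [k < m] ([is_muE]). What remains is the expansion of [I_y] displayed
above, for [0 <= y <= 1], endpoint 1 included ([cvg_inc_beta]).

That expansion is the binomial series of [(1 - v)^(n-1)], multiplied by
[v^(m-1)] and integrated term by term over [0 <= v < y]. With
[c_i = (-1)^i C(n-1, i)], the relation [c_i - c_(i+1) = n c_i / (i+1)] shows
that [|c_i|] is eventually nonincreasing and that the series of [|c_i| / (i+1)]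
telescopes ([onem_coef_bounded]). Hence the sum of the integrals of
[|c_i| v^(m-1+i)] is finite even for [y = 1], and dominated convergence applies.
The binomial series itself is obtained from the mean value theorem: the Taylor
polynomials satisfy the differential equation of [(1 - v)^(n-1)] up to one
monomial ([onem_taylor_ode]). *)

(** * Coefficients of the binomial series *)

Lemma rbin0 (R : realType) (x : R) : rbin x 0 = 1.
Proof. by rewrite /rbin big_ord0 fact0 divr1. Qed.

Lemma rbinS (R : realType) (x : R) i :
  rbin x i.+1 * i.+1%:R = rbin x i * (x - i%:R).
Proof.
rewrite /rbin big_ord_recr /= factS natrM.
have i1 : i.+1%:R != 0 :> R by rewrite pnatr_eq0.
have f0 : i`!%:R != 0 :> R by rewrite pnatr_eq0 -lt0n fact_gt0.
by move: i1 f0; move: (i.+1%:R) (i`!%:R) => u w u0 w0; field; rewrite u0 w0.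
Qed.

(** Coefficient of [v ^ i] in the power series of [(1 - v) `^ (n - 1)]. *)
Definition onem_coef (R : realType) (n : R) (i : nat) : R :=
  (-1) ^+ i * rbin (n - 1) i.

Lemma onem_coef0 (R : realType) (n : R) : onem_coef n 0 = 1.
Proof. by rewrite /onem_coef rbin0 mulr1. Qed.

Lemma onem_coefS (R : realType) (n : R) i :
  onem_coef n i.+1 * i.+1%:R = onem_coef n i * (i.+1%:R - n).
Proof. by rewrite /onem_coef -mulrA rbinS exprS -[i.+1]addn1 natrD; ring. Qed.

(** By [onem_coefS], [|c_i| - |c_(i+1)| = n |c_i| / (i+1)] as soon as
[n <= i + 1], so the left-hand side is eventually constant in [N]. One bound
serves two purposes: the coefficients are bounded, and the series of
[|c_i| / (i+1)] converges. *)
Lemma onem_coef_bounded (R : realType) (n : R) : 0 < n ->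
  exists K : R, forall N,
    \sum_(i < N) `|onem_coef n i| / i.+1%:R + `|onem_coef n N| / n <= K.
Proof.
move=> n0.
set w := fun N : nat =>
  \sum_(i < N) `|onem_coef n i| / i.+1%:R + `|onem_coef n N| / n.
have w0 N : 0 <= w N.
  by apply: addr_ge0; [apply: sumr_ge0 => i _|]; rewrite divr_ge0 // ltW.
have wS N : n <= N.+1%:R -> w N.+1 = w N.
  move=> nN; have N0 : N.+1%:R != 0 :> R by rewrite pnatr_eq0.
  have -> : w N.+1 = \sum_(i < N) `|onem_coef n i| / i.+1%:R
             + `|onem_coef n N| / N.+1%:R + `|onem_coef n N.+1| / n.
    by rewrite /w big_ord_recr.
  have -> : `|onem_coef n N.+1| = `|onem_coef n N| * (N.+1%:R - n) / N.+1%:R.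
    rewrite -[X in _ * X / _]ger0_norm ?subr_ge0 // -normrM -onem_coefS.
    rewrite [in RHS]normrM.
    by rewrite (ger0_norm (ler0n R N.+1)) mulfK.
  rewrite /w -addrA; congr (_ + _); move: N0; move: (N.+1%:R) => u u0.
  by field; rewrite u0 gt_eqF.
(* From [i0] on, [w] is constant, so the sum of its first values bounds it. *)
have [i0 ni0] : exists i0 : nat, n <= i0%:R.
  by exists (Num.truncn n).+1; rewrite ltW // truncnS_gt.
exists (\sum_(i < i0.+1) w i) => N; rewrite -/(w N).
elim: N => [|N IH].
  by rewrite big_ord_recl lerDl sumr_ge0.
have [Ni0|Ni0] := ltnP N i0.
  rewrite (bigD1 (Ordinal (Ni0 : (N.+1 < i0.+1)%N))) //= lerDl.
  by rewrite sumr_ge0.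
by rewrite wS // (le_trans ni0) // ler_nat (leq_trans Ni0).
Qed.

(** With [w] the square root of [v], half of the power compensates the factor
[N + 1]: [(N + 1) w ^ N <= 1 / (1 - w)], and the other half tends to 0. *)
Lemma cvg_natrM_expr (R : realType) (v : R) : 0 <= v < 1 ->
  (N.+1%:R * v ^+ N) @[N --> \oo] --> (0 : R).
Proof.
move=> /andP[v0 v1]; pose w := Num.sqrt v.
have w0 : 0 <= w by rewrite sqrtr_ge0.
have w1 : w < 1 by rewrite -sqrtr1 ltr_sqrt.
have vw : v = w ^+ 2 by rewrite sqr_sqrtr.
apply: (@squeeze_cvgr _ _ _ _ (cst 0) (fun N => w ^+ N / (1 - w))).
- apply: nearW => N; rewrite mulr_ge0 ?exprn_ge0 //=.
  (* N.+1 * w ^ N is at most the partial geometric sum, hence 1 / (1 - w). *)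
  rewrite vw -exprM mul2n -addnn exprD mulrA mulrC.
  rewrite ler_wpM2l ?exprn_ge0 // -[leRHS]mul1r ler_pdivlMr ?subr_gt0 //.
  have : N.+1%:R * w ^+ N <= \sum_(i < N.+1) w ^+ i.
    rewrite mulr_natl -[X in _ *+ X]card_ord -sumr_const ler_sum // => i _.
    by rewrite ler_wiXn2l // ?ltW // -ltnS.
  have := subrX1 w N.+1.
  have : 0 <= w ^+ N.+1 by rewrite exprn_ge0.
  move: (\sum_(i < _) _) (N.+1%:R * _) (w ^+ N.+1) => S u p; nra.
- exact: cvg_cst.
- rewrite -[X in _ --> X](mul0r (1 - w)^-1); apply: cvgMr_tmp.
  by apply: cvg_expr; rewrite ger0_norm.
Qed.

(** * The binomial series *)

Definition onem_taylor (R : realType) (n : R) (N : nat) : {poly R} :=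
  \sum_(i < N) onem_coef n i *: 'X^i.

Lemma onem_taylorE (R : realType) (n : R) N v :
  (onem_taylor n N).[v] = \sum_(i < N) onem_coef n i * v ^+ i.
Proof.
rewrite /onem_taylor horner_sum; apply: eq_bigr => i _.
by rewrite hornerZ hornerXn.
Qed.

Lemma onem_taylor0 (R : realType) (n : R) N : (onem_taylor n N.+1).[0] = 1.
Proof.
rewrite onem_taylorE big_ord_recl onem_coef0 mulr1 big1 ?addr0 // => i _.
by rewrite exprS mul0r mulr0.
Qed.

(** The function [y = (1 - v) `^ (n - 1)] solves [(1 - v) y' + (n - 1) y = 0].
For its Taylor polynomial, the recurrence between the coefficients cancels every
monomial except the last one. *)
Lemma onem_taylor_ode (R : realType) (n : R) N v :
  (1 - v) * (onem_taylor n N)^`().[v] + (n - 1) * (onem_taylor n N).[v] =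
  - (onem_coef n N * N%:R * v ^+ N.-1).
Proof.
elim: N => [|N IH].
  by rewrite /onem_taylor big_ord0 deriv0 !horner0 !mulr0 mul0r addr0 oppr0.
have -> : onem_taylor n N.+1 = onem_taylor n N + onem_coef n N *: 'X^N.
  by rewrite /onem_taylor big_ord_recr.
rewrite derivD derivZ derivXn !hornerE hornerMn hornerXn onem_coefS /=.
have vN : N%:R * v ^+ N = N%:R * v ^+ N.-1 * v.
  by case: N {IH} => [|N]; rewrite ?mul0r //= exprSr mulrA.
rewrite -[N.+1]addn1 natrD -mulr_natr.
move: IH vN; move: (onem_taylor n N).[v] (_^`().[v]) (onem_coef n N).
move: (v ^+ N.-1) (v ^+ N) => y z p q c IH vN.
have -> : (1 - v) * (q + c * (y * N%:R)) + (n - 1) * (p + c * z)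
  = ((1 - v) * q + (n - 1) * p) + c * (N%:R * y) - c * (N%:R * y * v)
    + (n - 1) * c * z by ring.
by rewrite IH -vN; ring.
Qed.

(** The quotient of the Taylor polynomial by [(1 - v) `^ (n - 1)], whose
derivative is a single term thanks to [onem_taylor_ode]. *)
Lemma is_derive_onem_taylorM (R : realType) (n : R) (N : nat) (v : R) : v < 1 ->
  is_derive v (1 : R) (fun v : R => (onem_taylor n N).[v] * (1 - v) `^ (1 - n))
    (- (onem_coef n N * N%:R * v ^+ N.-1) * (1 - v) `^ (- n)).
Proof.
move=> v1; have w0 : 0 < 1 - v by rewrite subr_gt0.
have dp : is_derive (1 - v) (1 : R) (@powR R ^~ (1 - n))
    ((1 - n) * (1 - v) `^ (- n)).
  by have := is_derive1_powR (1 - n) w0; rewrite (_ : 1 - n - 1 = - n) //; ring.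
have dq : is_derive v (1 : R) (fun x : R => 1 - x) (-1).
  have := @is_deriveB _ _ _ (cst (1 : R)) id v 1 _ _
    (is_derive_cst _ _ _) (is_derive_id _ _).
  by rewrite sub0r.
have dc := @is_derive1_comp _ (@powR R ^~ (1 - n)) (fun x => 1 - x) v _ _ dp dq.
have dm := @is_deriveM _ _ (horner (onem_taylor n N)) _ v 1 _ _ _ dc.
apply: is_derive_eq.
rewrite -onem_taylor_ode /GRing.scale /=.
have -> : (1 - v) `^ (1 - n) = (1 - v) * (1 - v) `^ (- n).
  by rewrite powRD ?powRr1 ?ltW //; apply/implyP => _; rewrite gt_eqF.
ring.
Qed.

(** By the mean value theorem the quotient of [is_derive_onem_taylorM] differs
from its value 1 at 0 by at most a constant times [N.+1 * v ^ N]. *)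
Lemma cvg_binomial_series (R : realType) (n v : R) : 0 < n -> 0 <= v < 1 ->
  (onem_taylor n N).[v] @[N --> \oo] --> (1 - v) `^ (n - 1).
Proof.
move=> n0 /andP[v0 v1]; have w0 : 0 < 1 - v by rewrite subr_gt0.
have [K cK] := onem_coef_bounded n0.
have cN N : `|onem_coef n N| <= n * K.
  rewrite mulrC -ler_pdivrMr //; apply: le_trans (cK N).
  by rewrite lerDr sumr_ge0 // => i _; rewrite divr_ge0.
pose C := n * K * (1 - v) `^ (- n) * v.
suff D1 : (onem_taylor n N.+1).[v] * (1 - v) `^ (1 - n) @[N --> \oo]
    --> (1 : R).
  have nm : (1 - v) `^ (1 - n) * (1 - v) `^ (n - 1) = 1.
    rewrite -powRD; last by apply/implyP => _; rewrite gt_eqF.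
    by rewrite (_ : 1 - n + (n - 1) = 0) ?powRr0 //; ring.
  rewrite -(cvg_shiftn 1).
  have -> : [sequence (onem_taylor n (N + 1)).[v]]_N = (fun N =>
      (onem_taylor n N.+1).[v] * (1 - v) `^ (1 - n) * (1 - v) `^ (n - 1)).
    by apply/funext => N /=; rewrite -mulrA nm mulr1 addn1.
  have := cvgMr_tmp (b := (1 - v) `^ (n - 1)) D1.
  by rewrite mul1r => H; exact: H.
apply/cvgrPdist_le => /= e e0.
(* [C] collects the bound [n * K] on the coefficients, the maximum of the power
   [(1 - x) `^ (- n)] over [0 <= x <= v] and the length [v] of the interval. *)
have : (C * (N.+1%:R * v ^+ N)) @[N --> \oo] --> (0 : R).
  have vv : 0 <= v < 1 by rewrite v0.
  have := cvgMl_tmp (a := C) (cvg_natrM_expr vv).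
  by rewrite mulr0 => H; exact: H.
move/cvgrPdist_le => /(_ e e0) /=; apply: filterS => N.
rewrite sub0r normrN => /(le_trans _); apply; apply: le_trans (ler_norm _).
pose F (x : R) := (onem_taylor n N.+1).[x] * (1 - x) `^ (1 - n).
pose dF (x : R) := - (onem_coef n N.+1 * N.+1%:R * x ^+ N) * (1 - x) `^ (- n).
have FdF (x : R) : x <= v -> is_derive x (1 : R) F (dF x).
  by move=> xv; apply: is_derive_onem_taylorM; exact: le_lt_trans v1.
have [x /[!in_itv]/= /andP[_ /ltW/FdF//]||x] := @MVT_segment R F dF 0 v v0.
  apply: derivable_within_continuous => x; rewrite in_itv /= => /andP[_ xv].
  exact: (@ex_derive _ _ _ _ _ _ _ (FdF x xv)).
rewrite in_itv /= => /andP[x0 xv].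
rewrite /F /dF !subr0 powR1 onem_taylor0 mulr1 distrC => ->.
have wx0 : 0 < 1 - x by apply: lt_le_trans w0 _; rewrite lerD2l lerN2.
have xN : x ^+ N <= v ^+ N by rewrite lerXn2r.
have xn : (1 - x) `^ (- n) <= (1 - v) `^ (- n).
  rewrite !powRN lef_pV2 ?posrE ?powR_gt0 //.
  by apply: ge0_ler_powR; rewrite ?nnegrE ?lerD2l ?lerN2 // ltW.
move: (cN N.+1); move: (onem_coef n N.+1) => c cK1.
rewrite !normrM normrN !normrM (ger0_norm v0) (ger0_norm (ler0n R _)).
rewrite (ger0_norm (exprn_ge0 N x0)) (ger0_norm (powR_ge0 _ _)).
have -> : C * (N.+1%:R * v ^+ N) =
    n * K * N.+1%:R * v ^+ N * (1 - v) `^ (- n) * v by rewrite /C; ring.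
rewrite ler_wpM2r // ler_pM ?powR_ge0 ?mulr_ge0 ?exprn_ge0 //.
by rewrite ler_pM ?mulr_ge0 ?exprn_ge0 // ler_wpM2r.
Qed.

(** * The incomplete beta function as a power series *)

Lemma integral_exprn (R : realType) (x : R) k : 0 <= x ->
  (\int[@lebesgue_measure R]_(v in `[0%R, x[) (v ^+ k)%:E
   = (x ^+ k.+1 / k.+1%:R)%:E)%E.
Proof.
rewrite le_eqVlt => /predU1P[<-|x0].
  by rewrite set_itvco0 integral_set0 exprS !mul0r.
rewrite integral_itv_bndo_bndc; last by apply/measurable_EFinP.
pose p : {poly R} := k.+1%:R^-1 *: 'X^(k.+1).
have pE v : p.[v] = v ^+ k.+1 / k.+1%:R.
  by rewrite hornerZ hornerXn mulrC.
have dpE v : p^`().[v] = v ^+ k.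
  rewrite derivZ derivXn hornerZ hornerMn hornerXn.
  by rewrite -[v ^+ _ *+ _]mulr_natl mulKf ?pnatr_eq0.
rewrite (@continuous_FTC2 _ _ (horner p)) //.
- by rewrite !pE expr0n mul0r sube0.
- apply: continuous_subspaceT; exact: exprn_continuous.
- split.
  + by move=> v _; exact: derivable_horner.
  + by apply: cvg_at_right_filter; exact: continuous_horner.
  + by apply: cvg_at_left_filter; exact: continuous_horner.
- by move=> v _; rewrite -derivE dpE.
Qed.

(** The interval is half-open because the binomial series need not converge at
[v = 1]. The dominating function is the series of [|c_i| v ^ (m + i)]; its
integral is at most the sum of the [|c_i| / (i + 1)], whatever [x <= 1] is. *)
Lemma cvg_inc_beta (R : realType) (n x : R) (m : nat) :
  0 < n -> 0 <= x <= 1 ->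
  \sum_(i < N) onem_coef n i * (x ^+ (m + i).+1 / (m + i).+1%:R) @[N --> \oo]
    --> inc_beta m.+1%:R n x.
Proof.
move=> n0 /andP[x0 x1].
pose D : set R := `[0, x[%classic.
have mD : measurable D by exact: measurable_itv.
have D01 v : D v -> 0 <= v < 1.
  by rewrite /D /= in_itv /= => /andP[-> /lt_le_trans]; apply.
pose f (v : R) := (v `^ (m.+1%:R - 1) * (1 - v) `^ (n - 1)).
have mf : measurable_fun D f.
  apply: measurable_funM.
    by apply: measurable_funTS; exact: measurable_powR.
  apply: (measurableT_comp (measurable_powR (n - 1))).
  exact: measurable_funB.
pose h i (v : R) := onem_coef n i * v ^+ (m + i).
have mXn k : measurable_fun D (EFin \o (fun v : R => v ^+ k)).
  by apply/measurable_EFinP; exact: exprn_measurable.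
have iXn k : lebesgue_measure.-integrable D (EFin \o (fun v : R => v ^+ k)).
  apply/integrableP; split; first exact: mXn.
  apply: le_lt_trans (ltry (x ^+ k.+1 / k.+1%:R)).
  rewrite -integral_exprn // le_eqVlt; apply/orP; left; apply/eqP.
  apply: eq_integral => v /set_mem/D01/andP[v0 _].
  by rewrite gee0_abs // lee_fin exprn_ge0.
have intX (c : R) k : (\int[lebesgue_measure]_(v in D) (c * v ^+ k)%:E
    = (c * (x ^+ k.+1 / k.+1%:R))%:E)%E.
  under eq_integral do rewrite EFinM.
  rewrite (integralZl _ (iXn k)) // [RHS]EFinM; congr (_ * _)%E.
  exact: integral_exprn.
pose g (v : R) : \bar R :=
  (\sum_(0 <= i <oo) (`|onem_coef n i| * v ^+ (m + i))%:E)%E.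
have g0 i v : D v -> (0 <= (`|onem_coef n i| * v ^+ (m + i))%:E)%E.
  by move=> /D01/andP[v0 _]; rewrite lee_fin mulr_ge0 ?exprn_ge0.
have mgi i : measurable_fun D (fun v => (`|onem_coef n i| * v ^+ (m + i))%:E).
  by apply/measurable_EFinP; apply: measurable_funM => //.
have ig : lebesgue_measure.-integrable D g.
  apply/integrableP; split.
    by apply: ge0_emeasurable_sum => [i v Dv _|i _]; [exact: g0|exact: mgi].
  have -> : (\int[lebesgue_measure]_(v in D) `|g v| =
             \int[lebesgue_measure]_(v in D) g v)%E.
    apply: eq_integral => v /set_mem Dv; rewrite gee0_abs //.
    by apply: nneseries_ge0 => i _ _; exact: g0.
  rewrite integral_nneseries //.
  have [K cK] := onem_coef_bounded n0.
  apply: (@le_lt_trans _ _ K%:E); last exact: ltry.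
  apply: lime_le.
    by apply: is_cvg_nneseries => i _ _; apply: integral_ge0 => v; exact: g0.
  apply: nearW => N; under eq_bigr do rewrite intX.
  rewrite sumEFin lee_fin big_mkord; apply: le_trans (cK N).
  rewrite -[leLHS]addr0 lerD ?divr_ge0 ?(ltW n0) // ler_sum // => i _.
  rewrite ler_wpM2l // -[leRHS]mul1r ler_pM ?invr_ge0 ?exprn_ge0 //.
    by rewrite exprn_ile1.
  by rewrite lef_pV2 ?posrE ?ltr0n // ler_nat ltnS leq_addl.
have fl (v : R) : D v ->
    (\sum_(i < N) h i v)%:E @[N --> \oo] --> (f v)%:E.
  move=> Dv; have /andP[v0 v1] := D01 v Dv.
  apply: cvg_EFin; first exact: nearW.
  have -> : f v = v ^+ m * (1 - v) `^ (n - 1).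
    by rewrite /f -natr1 addrK powR_mulrn.
  have vv : 0 <= v < 1 by rewrite v0.
  have -> : fine \o (fun N => (\sum_(i < N) h i v)%:E)
      = (fun N => v ^+ m * (onem_taylor n N).[v]).
    apply/funext => N /=; rewrite onem_taylorE mulr_sumr; apply: eq_bigr => i _.
    by rewrite /h exprD mulrCA.
  by have := cvgMl_tmp (a := v ^+ m) (cvg_binomial_series n0 vv) => H; exact: H.
have fg N (v : R) : D v -> (`|(\sum_(i < N) h i v)%:E| <= g v)%E.
  move=> Dv; have /andP[v0 v1] := D01 v Dv.
  apply: le_trans (nneseries_lim_ge N (fun i _ _ => g0 i v Dv)).
  rewrite sumEFin lee_fin big_mkord; apply: le_trans (ler_norm_sum _ _ _) _.
  by apply: ler_sum => i _; rewrite /h normrM (ger0_norm (exprn_ge0 _ v0)).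
have mS N : measurable_fun D (fun v : R => (\sum_(i < N) h i v)%:E).
  apply/measurable_EFinP; apply: measurable_sum => i.
  by apply: measurable_funM => //; exact: exprn_measurable.
have mfE : measurable_fun D (EFin \o f) by apply/measurable_EFinP.
have [||iF _ cF] := @dominated_convergence _ (measurableTypeR R) R
  lebesgue_measure D mD _ _ _ mS mfE _ ig _.
- by apply: aeW => v; exact: fl.
- by apply: aeW => v N; exact: fg.
have -> : inc_beta m.+1%:R n x =
    fine (\int[lebesgue_measure]_(v in D) (f v)%:E)%E.
  by rewrite /inc_beta /Rintegral integral_itv_bndo_bndc.
have -> : (fun N =>
      \sum_(i < N) onem_coef n i * (x ^+ (m + i).+1 / (m + i).+1%:R)) =
    fine \o (fun N =>
      \int[lebesgue_measure]_(v in D) (\sum_(i < N) h i v)%:E)%E.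
  apply/funext => N /=; under eq_integral do rewrite -sumEFin.
  rewrite integral_sum //; last first.
    by move=> i; exact: (@integrableZl _ (measurableTypeR R) R _ _ mD
      (onem_coef n i) _ (iXn (m + i)%N)).
  transitivity (fine (\sum_(i < N)
      onem_coef n i * (x ^+ (m + i).+1 / (m + i).+1%:R))%:E) => //.
  by rewrite -sumEFin; congr fine; apply: eq_bigr => i _; rewrite -intX.
apply: fine_cvg; rewrite fineK; first exact: cF.
exact: integrable_fin_num.
Qed.

(** * The inner series of the coefficients *)

(** Term of the formal coefficient of [y ^ k] in
[(1 - (1 - y)) ^ x = sum_j (-1)^j C(x, j) (1 - y)^j]. *)
Definition double_binom (R : realType) (x : R) (k j : nat) : R :=
  (-1) ^+ (j + k) * rbin x j * 'C(j, k)%:R.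

Lemma mu_termE (R : realType) (m n : R) k i j :
  mu_term m n k i j =
  onem_coef n i / (betaR m n * (m + i%:R)) * double_binom (m + i%:R) k j.
Proof. by rewrite /mu_term /onem_coef /double_binom -addnA exprD; ring. Qed.

Lemma double_binomS (R : realType) (x : R) k j : (k <= j)%N ->
  (j.+1 - k)%:R * double_binom x k j.+1 = (j%:R - x) * double_binom x k j.
Proof.
move=> kj; rewrite /double_binom mulrCA -natrM -mul_bin_down natrM addSn exprS.
transitivity (- ((-1) ^+ (j + k) * (rbin x j.+1 * j.+1%:R) * 'C(j, k)%:R)).
  by ring.
by rewrite rbinS; ring.
Qed.

(** The terms satisfy a first-order recurrence, so that
[(N - k) * double_binom x k N] has the difference
[(k - x) * double_binom x k N] and the sum telescopes. *)
Lemma double_binom_sum (R : realType) (x : R) k N : (k <= N)%N ->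
  (k%:R - x) * \sum_(k <= j < N) double_binom x k j =
  (N - k)%:R * double_binom x k N.
Proof.
elim: N => [|N IH].
  by rewrite leqn0 => /eqP->; rewrite big_nil mulr0 mul0r.
rewrite leq_eqVlt => /predU1P[->|].
  by rewrite big_geq // subnn mulr0 mul0r.
rewrite ltnS => kN; rewrite big_nat_recr //= mulrDr IH // double_binomS //.
by rewrite -mulrDl natrB // subrKA.
Qed.

Lemma rbin_nat (R : realType) (p j : nat) : rbin (p%:R : R) j = 'C(p, j)%:R.
Proof.
elim: j => [|j IH]; first by rewrite rbin0 bin0.
apply: (@mulIf _ j.+1%:R); first by rewrite pnatr_eq0.
rewrite rbinS IH -natrM [in RHS]mulnC mul_bin_left.
have [pj|jp] := ltnP p j; first by rewrite bin_small // muln0 mul0r.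
by rewrite natrM natrB // mulrC.
Qed.

(** For [k <> p] the closed form of [double_binom_sum] vanishes beyond [p],
since [C(p, N) = 0]; for [k = p] only the term [j = p] is nonzero. *)
Lemma double_binom_sum_nat (R : realType) (p k N : nat) : (p < N)%N ->
  \sum_(k <= j < N) double_binom (p%:R : R) k j = (k == p)%:R.
Proof.
move=> pN.
have double_binom0 l j : (p < j)%N -> double_binom (p%:R : R) l j = 0.
  by move=> pj; rewrite /double_binom rbin_nat bin_small // mulr0 mul0r.
have [->|kp] := eqVneq k p.
  rewrite big_ltn // big_nat big1 => [|j /andP[pj _]].
    rewrite /double_binom rbin_nat binn !mulr1 addr0.
    by rewrite addnn -signr_odd odd_double.
  exact: double_binom0.
have [Nk|kN] := leqP N k; first by rewrite big_geq.
apply: (@mulfI _ (k%:R - p%:R)); first by rewrite subr_eq0 eqr_nat.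
by rewrite double_binom_sum 1?ltnW // double_binom0 // !mulr0.
Qed.

Lemma double_binom_diag_neq0 (R : realType) (x : R) k :
  x \isn't a Num.nat -> double_binom x k k != 0.
Proof.
move=> xN; rewrite /double_binom binn mulr1 mulf_neq0 ?signr_eq0 //.
elim: k => [|k IH]; first by rewrite rbin0 oner_eq0.
suff : rbin x k.+1 * k.+1%:R != 0 by rewrite mulf_eq0 negb_or => /andP[].
rewrite rbinS mulf_neq0 // subr_eq0; apply: contraNneq xN => ->.
exact: natr_nat.
Qed.

(** The ratio of consecutive terms is [(j - x) / (j + 1 - k)] in absolute value,
which is at least 1 when [k >= x + 1]. *)
Lemma double_binom_growing (R : realType) (x : R) k j :
  x + 1 <= k%:R -> (k <= j)%N -> `|double_binom x k k| <= `|double_binom x k j|.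
Proof.
move=> xk; elim: j => [|j IH]; first by rewrite leqn0 => /eqP->.
rewrite leq_eqVlt => /predU1P[->//|]; rewrite ltnS => kj.
apply: le_trans (IH kj) _.
have kj' : k%:R <= j%:R :> R by rewrite ler_nat.
have d0 : 0 < (j.+1 - k)%:R :> R by rewrite ltr0n subn_gt0.
have dE : (j.+1 - k)%:R = j%:R + 1 - k%:R :> R by rewrite natrB ?natr1 // ltnW.
have xj : 0 <= j%:R - x by lra.
have := double_binomS x kj.
move: (double_binom x k j) (double_binom x k j.+1) => p q E.
rewrite -(ler_pM2l d0) -[in leRHS](gtr0_norm d0) -normrM E normrM.
by rewrite (ger0_norm xj) ler_wpM2r //; lra.
Qed.

(** * Existence and value of the coefficients *)

(** If [m] is not a natural number, the terms of the inner series for [i = 0]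
and [k >= m + 1] stay away from 0, so this series cannot converge. *)
Lemma is_mu_nat (R : realType) (m n : R) (mu : nat -> R) :
  m != 0 -> betaR m n != 0 -> (forall k, is_mu m n k (mu k)) -> m \is a Num.nat.
Proof.
move=> m0 B0 hmu; apply/negPn/negP => mN.
pose k := (Num.truncn (m + 1)).+1.
have mk : m + 1 <= k%:R by rewrite ltW // truncnS_gt.
have [u [/(_ 0%N) cu _]] := hmu k.
pose c := (betaR m n * m)^-1.
have c0 : c != 0 by rewrite invr_eq0 mulf_neq0.
have cvg0 : mu_term m n k 0 N @[N --> \oo] --> (0 : R).
  have cu1 : \sum_(k <= j < N.+1) mu_term m n k 0 j @[N --> \oo] --> u 0%N.
    by move: cu; rewrite -(cvg_shiftn 1); under eq_fun do rewrite addn1.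
  have cB : (\sum_(k <= j < N.+1) mu_term m n k 0 j
      - \sum_(k <= j < N) mu_term m n k 0 j) @[N --> \oo] --> (0 : R).
    by have := cvgB cu1 cu; rewrite subrr => H; exact: H.
  apply: (cvg_trans (near_eq_cvg _) cB); exists k => // N /= kN.
  by rewrite big_nat_recr //= [X in X - _]addrC addrK.
have : 0 < `|c * double_binom m k k|.
  by rewrite normr_gt0 mulf_neq0 // double_binom_diag_neq0.
move/cvgrPdist_lt : cvg0 => /[apply] -[N0 _ /(_ (maxn N0 k) (leq_maxl _ _))] /=.
rewrite sub0r normrN mu_termE addr0 onem_coef0 mul1r -/c !(normrM c).
by rewrite ltr_pM2l ?normr_gt0 // ltNge double_binom_growing // leq_maxr.
Qed.

(** The index [i] contributes to [mu_k] only when [m + i = k], by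
[double_binom_sum_nat]. *)
Lemma is_muE (R : realType) (M : nat) (n s : R) k : is_mu M.+1%:R n k s ->
  s = if (M < k)%N then onem_coef n (k - M.+1) / (betaR M.+1%:R n * k%:R)
      else 0.
Proof.
move=> [u [cu cs]]; set B := betaR _ _ in cu *.
have uE i : u i = if (M.+1 + i)%N == k then onem_coef n i / (B * k%:R) else 0.
  apply: (cvg_unique _ (cu i)) => //; apply: cvg_near_cst.
  exists (M.+1 + i).+1 => // N /= iN; under eq_bigr do rewrite mu_termE -natrD.
  rewrite -mulr_sumr double_binom_sum_nat // eq_sym.
  by case: eqVneq => [->|_]; rewrite ?mulr1 ?mulr0.
apply: (cvg_unique _ cs) => //; apply: cvg_near_cst.
exists k => // N /= kN; rewrite seriesEord /=; under eq_bigr do rewrite uE.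
case: ifPn => Mk; last first.
  apply: big1 => i _; case: eqP => // Mi.
  by move: Mk; rewrite -Mi leq_addr.
have kMN : (k - M.+1 < N)%N.
  by apply: leq_trans kN; rewrite ltn_subrL (leq_trans _ Mk).
rewrite (bigD1 (Ordinal kMN)) //= subnKC // eqxx big1 ?addr0 // => i.
rewrite -val_eqE /= => ik; case: eqP => // Mi.
by move: ik; rewrite -Mi addKn eqxx.
Qed.

(** When [betaR m n = 0], the convention [0^-1 = 0] makes every term vanish,
whatever [m] is; this is the case excluded from [is_mu_nat]. *)
Lemma is_mu_betaR0 (R : realType) (m n s : R) k :
  betaR m n = 0 -> is_mu m n k s -> s = 0.
Proof.
move=> B0 [u [cu cs]].
have uE i : u i = 0.
  apply: (cvg_unique _ (cu i)) => //; apply: cvg_near_cst; apply: nearW => N.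
  by apply: big1 => j _; rewrite mu_termE B0 mul0r invr0 mulr0 mul0r.
apply: (cvg_unique _ cs) => //; apply: cvg_near_cst; apply: nearW => N.
by rewrite seriesEord /=; apply: big1 => i _; rewrite uE.
Qed.

(** * The expansion of the distribution function *)

Lemma KwG_cdf_itv (R : realType) (G : R -> R) (a b t : R) :
  0 < a -> 0 < b -> 0 <= G t <= 1 -> 0 <= KwG_cdf G a b t <= 1.
Proof.
have pow01 (y c : R) : 0 < c -> 0 <= y <= 1 -> 0 <= 1 - y `^ c <= 1.
  move=> c0 /andP[y0 y1]; rewrite lerBlDr lerDl powR_ge0 subr_ge0 andbT.
  have -> : 1 = (1 : R) `^ c by rewrite powR1.
  by apply: ge0_ler_powR; rewrite ?nnegrE // ltW.
by move=> a0 b0 Gt; apply: (pow01) => //; exact: pow01.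
Qed.

Theorem mainTheorem3 (R : realType) (d : measure_display)
    (T : measurableType d) (P : probability T R) (X : {RV P >-> R})
    (G g : R -> R) (hG : baseline_cdf X G g)
    (a b m n : R) (ha : 0 < a) (hb : 0 < b) (hm : 0 < m) (hn : 0 < n)
    (mu : nat -> R) (hmu : forall k : nat, is_mu m n k (mu k))
    (t : R) (ht : 0 < t) :
  (\sum_(0 <= k < N) mu k * KwG_cdf G a b t ^+ k) @[N --> \oo]
    --> BKwG_cdf G a b m n t.
Proof.
have Gt : 0 <= G t <= 1.
  by rewrite -!lee_fin -(hG.1 t) cdf_ge0 cdf_le1.
have x01 := KwG_cdf_itv ha hb Gt.
rewrite /BKwG_cdf -/(KwG_cdf G a b t) /inc_beta_ratio.
move: (KwG_cdf G a b t) x01 => x x01.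
have [B0|B0] := eqVneq (betaR m n) 0.
  (* Both sides are 0, by the convention on inverses. *)
  rewrite B0 invr0 mul0r; apply: cvg_near_cst; apply: nearW => N.
  by apply: big1 => k _; rewrite (is_mu_betaR0 B0 (hmu k)) mul0r.
have := is_mu_nat (lt0r_neq0 hm) B0 hmu => /natrP[[|M] mM].
  by move: hm; rewrite mM ltxx.
rewrite {m hm}mM in hmu B0 *.
(* The coefficients of index below [m = M.+1] vanish: sum from [k = m] on. *)
rewrite -(cvg_shiftn M.+1).
have -> : [sequence \sum_(0 <= k < N + M.+1) mu k * x ^+ k]_N = (fun N =>
    (betaR M.+1%:R n)^-1 *
    \sum_(i < N) onem_coef n i * (x ^+ (M + i).+1 / (M + i).+1%:R)).
  apply/funext => N /=.
  rewrite (@big_cat_nat _ _ _ M.+1) ?leq_addl //=.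
  rewrite big_nat big1 ?add0r; last first.
    by move=> k /andP[_ kM]; rewrite (is_muE (hmu k)) ltnNge -ltnS kM mul0r.
  rewrite -{1}[M.+1]add0n big_addn addnK big_mkord mulr_sumr.
  apply: eq_bigr => i _; rewrite (is_muE (hmu _)) addnS ltnS leq_addl subSS.
  rewrite addnK [(i + M)%N]addnC invfM; ring.
have := cvgMl_tmp (a := (betaR M.+1%:R n)^-1) (@cvg_inc_beta R n x M hn x01).
move=> H; exact: H.
Qed.
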